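(* Let $d\geq 2$ and $k\geq 3$ be integers, and let $V=\{p_1,\dots,p_k\}\subseteq\mathbb{R}^d$ be a set of $k$ distinct points no three of which are collinear. Then there is a Lebesgue measurable set $E\subseteq\mathbb{R}^d$ with positive upper density $\delta(E)>0$ such that for every $x\in E$ there exists $R(x)>0$ with $$(R(x),\infty)\cap D_x^V(E)=\emptyset .$$
   Context: For $A\subseteq\mathbb{R}^d$, the upper density is $\delta(A):=\limsup_{R\to\infty}\frac{\mathcal L^d(B(0,R)\cap A)}{R^d}$, where $\mathcal L^d$ is Lebesgue measure and $B(0,R)$ the open ball of radius $R$ centered at $0$. For a $k$-point pattern $V\subseteq\mathbb{R}^d$, a set $E\subseteq\mathbb{R}^d$ and $x\in\mathbb{R}^d$, the pinned scaling factor set is $D_x^V(E):=\{r>0:\ \exists\, O\in\mathcal O(d)\text{ such that } x+r\,O(V)\subseteq E\}$, where $\mathcal O(d)$ is the orthogonal group of $\mathbb{R}^d$. *)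

(* Defs.v *)
From HB Require Import structures.
From mathcomp Require Import all_boot all_order all_algebra.
From mathcomp Require Import all_classical all_reals all_analysis.
Import Order.TTheory GRing.Theory Num.Theory.
Import numFieldNormedType.Exports.

Set Implicit Arguments.
Unset Strict Implicit.
Unset Printing Implicit Defensive.

Local Open Scope classical_set_scope.
Local Open Scope ring_scope.

(* R^d is 'rV[R]_d. Beware that the norm `|x| and the predicate [ball] that   *)
(* MathComp-Analysis puts on matrices are those of the sup norm; the balls    *)
(* in the upper density are Euclidean, hence [enorm] and [eball].             *)
Definition enorm (R : realType) (d : nat) (x : 'rV[R]_d) : R :=
  Num.sqrt (\sum_(i < d) x 0 i ^+ 2).

Definition eball (R : realType) (d : nat) (c : 'rV[R]_d) (r : R) :
    set 'rV[R]_d :=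
  [set x : 'rV[R]_d | enorm (x - c) < r].

(* MathComp-Analysis has Lebesgue measure on R only, so the d-dimensional one *)
(* is built from the volume of half-open boxes, in the classical way: outer   *)
(* measure, then restriction to the Caratheodory-measurable sets.             *)
Definition box (R : realType) (d : nat) (a b : 'rV[R]_d) : set 'rV[R]_d :=
  [set x : 'rV[R]_d | forall i, a 0 i < x 0 i <= b 0 i].

(* Only meaningful when a 0 i <= b 0 i for all i, as [box_cover] requires. *)
Definition box_volume (R : realType) (d : nat) (a b : 'rV[R]_d) : R :=
  \prod_(i < d) (b 0 i - a 0 i).

Definition box_cover (R : realType) (d : nat) (A : set 'rV[R]_d) :
    set (nat -> 'rV[R]_d * 'rV[R]_d) :=
  [set F : nat -> 'rV[R]_d * 'rV[R]_d |
    (forall n i, (F n).1 0 i <= (F n).2 0 i) /\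
    A `<=` \bigcup_n box (F n).1 (F n).2].

(* On Lebesgue-measurable sets this is the Lebesgue measure of R^d. *)
Definition lebesgue_outer (R : realType) (d : nat) (A : set 'rV[R]_d) :
    \bar R :=
  ereal_inf [set (\sum_(0 <= n <oo) (box_volume (F n).1 (F n).2)%:E)%E
            | F in box_cover A].

Definition lebesgue_measurable (R : realType) (d : nat) (A : set 'rV[R]_d) :
    Prop :=
  caratheodory_measurable (@lebesgue_outer R d) A.

(* The ball is not normalised to volume 1: the quotient is by r ^ d. *)
Definition upper_density (R : realType) (d : nat) (A : set 'rV[R]_d) :
    \bar R :=
  limf_esup
    (fun r : R => (lebesgue_outer (eball 0 r `&` A) * ((r ^+ d)^-1)%:E)%E)
    (pinfty_nbhs R).

Definition collinear (R : realType) (d : nat) (A : set 'rV[R]_d) : Prop :=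
  exists q u : 'rV[R]_d,
    u != 0 /\ A `<=` [set x : 'rV[R]_d | exists t : R, x = q + t *: u].

Definition orthogonal_group (R : realType) (d : nat) : set 'M[R]_d :=
  [set O : 'M[R]_d | O *m O^T = 1%:M].

(* Vectors are rows, so a matrix O acts by v |-> v *m O. *)
Definition pattern_copy (R : realType) (d : nat) (V : set 'rV[R]_d)
    (x : 'rV[R]_d) (r : R) (O : 'M[R]_d) : set 'rV[R]_d :=
  [set x + r *: (v *m O) | v in V].

Definition pinned_scaling (R : realType) (d : nat) (V E : set 'rV[R]_d)
    (x : 'rV[R]_d) : set R :=
  [set r : R | 0 < r /\
    exists2 O : 'M[R]_d, orthogonal_group O & pattern_copy V x r O `<=` E].

(* Main.v *)
(* E is the union of the cubes Q_n = ]K^n, (1 + eps) K^n]^d for a large K and  *)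
(* a small eps. Since the side of Q_n is proportional to its distance to the  *)
(* origin, E has positive upper density. Among the points of the pattern pick *)
(* two, u and v, that are nonzero and distinct. For fixed x and large r, if   *)
(* x + r O(u) is in Q_n and x + r O(v) is in Q_m, then r|u| is comparable to  *)
(* K^n and r|v| to K^m. If n <> m, this contradicts the choice of K, the      *)
(* ratio |u|/|v| being fixed. If n = m, then r|u - v| is at most the diameter *)
(* of Q_n, of order eps K^n, that is eps r|u|, which contradicts the choice   *)
(* of eps.                                                                    *)
From HB Require Import structures.
Require Import Defs.
From mathcomp Require Import all_boot all_order all_algebra.
From mathcomp Require Import all_classical all_reals all_analysis.
From mathcomp Require Import measurable_realfun ring lra.
Import Order.TTheory GRing.Theory Num.Theory.
Import numFieldNormedType.Exports.
Set Implicit Arguments.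
Unset Strict Implicit.
Local Open Scope classical_set_scope.
Local Open Scope ring_scope.

(** The scales are fixed by the pattern alone. By [enorm_translate_cube], if y is long compared with
    x and x + y lies in the cube of scale rho, then |y| is comparable to rho, with constants
    depending only on the dimension. [geometric_cubes_avoid] applies this to two images r O(u) and r
    O(v) and gets the contradiction. Measurability of the cubes reduces to Caratheodory's criterion
    for half-spaces. Positive density needs a lower bound on the outer measure of a box,
    [lebesgue_outer_box], which comes from the slicing argument of [prod_le_nneseries]. *)

(** * Lebesgue outer measure from box covers *)

Lemma box_volume_ge0 (R : realType) d (a b : 'rV[R]_d) :
  (forall i, a 0 i <= b 0 i) -> 0 <= box_volume a b.
Proof. by move=> ab; apply: prodr_ge0 => i _; rewrite subr_ge0. Qed.

Lemma lebesgue_outer_ge0 (R : realType) d (A : set 'rV[R]_d) :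
  (0 <= lebesgue_outer A)%E.
Proof.
apply: le_ereal_inf_tmp => _ [F [F0 _] <-].
by apply: nneseries_ge0 => n _ _; rewrite lee_fin box_volume_ge0.
Qed.

Lemma le_lebesgue_outer (R : realType) d :
  {homo @lebesgue_outer R d : A B / A `<=` B >-> (A <= B)%E}.
Proof.
move=> A B AB; apply: ereal_inf_le_tmp => _ [F [F0 BF] <-].
by exists F => //; split => //; exact: subset_trans AB BF.
Qed.

(* False for d = 0, where every box has volume 1. *)
Lemma lebesgue_outer_set0 (R : realType) d :
  lebesgue_outer (set0 : set 'rV[R]_d.+1) = 0%E.
Proof.
apply/eqP; rewrite eq_le lebesgue_outer_ge0 andbT.
apply: ereal_inf_lbound; exists (fun=> (0, 0)); first by split.
apply: eseries0 => n _ _ /=.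
by rewrite /box_volume big_ord_recl !mxE subrr mul0r.
Qed.

Lemma lebesgue_outer_near_cover (R : realType) d (A : set 'rV[R]_d) (e : R) :
  0 < e -> lebesgue_outer A != +oo%E ->
  exists2 F, box_cover A F &
    (\sum_(0 <= n <oo) (box_volume (F n).1 (F n).2)%:E
       <= lebesgue_outer A + e%:E)%E.
Proof.
move=> e0 Aoo.
have Afin : lebesgue_outer A \is a fin_num.
  by rewrite ge0_fin_numE ?lebesgue_outer_ge0 // ltey.
have [_ [F AF <-] Fe] := lb_ereal_inf_adherent e0 Afin.
by exists F => //; exact: ltW.
Qed.

(** Covers of the A n within e / 2^(n+1) of optimal are merged into one sequence through a bijection
    of nat with nat * nat. *)
Lemma lebesgue_outer_sigma_subadditive (R : realType) d :
  sigma_subadditive (@lebesgue_outer R d).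
Proof.
move=> A; have [[i Ai]|] := pselect (exists i, lebesgue_outer (A i) = +oo%E).
  rewrite (eseries_pinfty _ _ Ai) ?leey// => n _.
  by rewrite -ltNye (lt_le_trans _ (lebesgue_outer_ge0 _)).
rewrite -forallNE => Afin; apply/lee_addgt0Pr => e e0.
apply: le_trans (epsilon_trick _ _ (ltW e0)); last first.
  by move=> n; exact: lebesgue_outer_ge0.
have /choice[G GP] n : exists F, box_cover (A n) F /\
    (\sum_(0 <= k <oo) (box_volume (F k).1 (F k).2)%:E
       <= lebesgue_outer (A n) + (e / (2 ^ n.+1)%:R)%:E)%E.
  have en : 0 < e / (2 ^ n.+1)%:R :> R by rewrite divr_gt0 // ltr0n expn_gt0.
  by have [|F ? ?] := lebesgue_outer_near_cover (A := A n) en;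
    [exact/eqP/Afin|exists F].
pose vol (k : nat * nat) : \bar R :=
  (box_volume (G k.1 k.2).1 (G k.1 k.2).2)%:E.
have vol0 k : (0 <= vol k)%E.
  by rewrite lee_fin; apply: box_volume_ge0; exact: (GP k.1).1.1.
have /card_esym/ppcard_eqP[f] := card_nat2.
apply: (@le_trans _ _ (\sum_(0 <= n <oo) \sum_(0 <= k <oo) vol (n, k))%E).
  rewrite nneseries_esumT; last by move=> n; exact: nneseries_ge0.
  under eq_esum do rewrite nneseries_esumT //.
  rewrite esum_esum //.
  rewrite (reindex_esum setT _ f) //; last first.
    split=> // -[n k] _.
    by exists (f^-1%FUN (n, k)) => //; rewrite invK ?inE.
  apply: ereal_inf_lbound; exists (fun i => G (f i).1 (f i).2); last first.
    by rewrite nneseries_esumT // => i; exact: (vol0 (f i)).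
  split => [i|x [n _ Anx]]; first exact: (GP (f i).1).1.1.
  have [k _ Gx] := (GP n).1.2 _ Anx.
  by exists (f^-1%FUN (n, k)) => //=; rewrite invK ?inE.
by apply: lee_nneseries => n *; [exact: nneseries_ge0|exact: (GP n).2].
Qed.

(** Gives access to the closure properties of Caratheodory-measurable sets. *)
HB.instance Definition _ (R : realType) d :=
  isOuterMeasure.Build R 'rV[R]_d.+1 (@lebesgue_outer R d.+1)
    (@lebesgue_outer_set0 R d) (@lebesgue_outer_ge0 R d.+1)
    (@le_lebesgue_outer R d.+1) (@lebesgue_outer_sigma_subadditive R d.+1).

(** * Measurability of boxes *)

Definition set_coord (R : realType) d (a : 'rV[R]_d) (i : 'I_d) (t : R) :
  'rV[R]_d := \row_j if j == i then t else a 0 j.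

Lemma box_volume_split (R : realType) d (a b : 'rV[R]_d) i t :
  box_volume a b =
  box_volume a (set_coord b i t) + box_volume (set_coord a i t) b.
Proof.
have cut (a' b' : 'rV[R]_d) :
    (forall j, j != i -> b' 0 j - a' 0 j = b 0 j - a 0 j) ->
    box_volume a' b' =
    (b' 0 i - a' 0 i) * \prod_(j < d | j != i) (b 0 j - a 0 j).
  by move=> eqab; rewrite /box_volume (bigD1 i) //=;
    congr (_ * _); exact: eq_bigr.
rewrite (cut a b) // cut; last by move=> j /negPf ji; rewrite mxE ji.
rewrite cut; last by move=> j /negPf ji; rewrite mxE ji.
by rewrite !mxE eqxx -mulrDl; congr (_ * _); ring.
Qed.

(** The hyperplane cuts each box of a cover of X in two; the lower pieces cover the part of X in the
    half-space, the upper ones the rest, and volumes add up. *)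
Lemma halfspace_measurable (R : realType) d (i : 'I_d.+1) (t : R) :
  lebesgue_measurable [set x : 'rV[R]_d.+1 | x 0 i <= t].
Proof.
apply: le_caratheodory_measurable => X.
apply: le_ereal_inf_tmp => _ [F [F0 XF] <-].
(* Clamping t to the i-th side keeps both pieces legitimate boxes when the hyperplane misses the
   box; one of them is then degenerate. *)
pose m n := Order.max ((F n).1 0 i) (Order.min ((F n).2 0 i) t).
have m_ge n : (F n).1 0 i <= m n by rewrite le_max lexx.
have m_le n : m n <= (F n).2 0 i by rewrite ge_max F0 ge_min lexx.
pose L n := ((F n).1, set_coord (F n).2 i (m n)).
pose U n := (set_coord (F n).1 i (m n), (F n).2).
have L0 n j : (L n).1 0 j <= (L n).2 0 j.
  by rewrite /= mxE; case: eqP => [->|_]; [exact: m_ge|exact: F0].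
have U0 n j : (U n).1 0 j <= (U n).2 0 j.
  by rewrite /= mxE; case: eqP => [->|_]; [exact: m_le|exact: F0].
under eq_eseriesr => n _ do rewrite (box_volume_split _ _ i (m n)) EFinD.
rewrite nneseriesD; last 2 first.
- by move=> n _ _; rewrite lee_fin; exact: (box_volume_ge0 (L0 n)).
- by move=> n _ _; rewrite lee_fin; exact: (box_volume_ge0 (U0 n)).
apply: leeD; apply: ereal_inf_lbound.
- exists L => //; split=> // x [/XF[n _ Fx] /= xt]; exists n => // j.
  have /andP[ax xb] := Fx j.
  rewrite /= mxE ax; case: eqP => [ji|_] //=; subst j.
  by rewrite /m le_max le_min xb xt orbT.
- exists U => //; split=> // x [/XF[n _ Fx] /= /negP xt]; exists n => // j.
  have /andP[ax xb] := Fx j.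
  rewrite /= mxE xb andbT; case: eqP => [ji|_] //=; subst j.
  by rewrite /m gt_max ax gt_min [t < _]ltNge xt orbT.
Qed.

Lemma box_measurable (R : realType) d (a b : 'rV[R]_d.+1) :
  lebesgue_measurable (box a b).
Proof.
have -> : box a b = \big[setI/setT]_(i < d.+1)
    ([set x : 'rV[R]_d.+1 | x 0 i <= b 0 i] `\`
     [set x : 'rV[R]_d.+1 | x 0 i <= a 0 i]).
  rewrite -bigcap_seq; apply/seteqP; split=> [x abx i _|x abx i] /=.
    by have /andP[? ?] := abx i; split=> //; apply/negP; rewrite -ltNge.
  have [/= xb /negP] := abx i (mem_index_enum i).
  by rewrite -ltNge => ax; rewrite ax.
apply: (big_ind (@lebesgue_measurable R d.+1)) => [|? ? ? ?|i _]; last first.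
- by apply: caratheodory_measurable_setD; exact: halfspace_measurable.
- exact: caratheodory_measurable_setI.
- rewrite -setC0; apply: caratheodory_measurable_setC.
  exact: caratheodory_measurable_set0.
Qed.

(** * Lower bound for the outer measure of a box *)

(* By induction on d, integrating over the last coordinate t. The selector [c] *)
(* is what makes the induction go through: slicing at t keeps only the boxes  *)
(* of the cover that meet the slice.                                          *)
Lemma prod_le_nneseries (R : realType) d (A B : nat -> R)
  (a b : nat -> nat -> R) (c : nat -> bool) :
  (forall i, A i <= B i) -> (forall n i, a n i <= b n i) ->
  (forall x : nat -> R, (forall i, (i < d)%N -> A i < x i <= B i) ->
     exists2 n, c n & forall i, (i < d)%N -> a n i < x i <= b n i) ->
  ((\prod_(i < d) (B i - A i))%:E <=
   \sum_(0 <= n <oo) ((c n)%:R * \prod_(i < d) (b n i - a n i))%:E)%E.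
Proof.
move=> AB ab; elim: d c => [|d IH] c cov.
  have [n cn _] := cov (fun=> 0) (fun i => ltac:(done)).
  rewrite big_ord0 (@nneseriesD1 _ _ n) // ; last first.
    by move=> k _; rewrite lee_fin mulr_ge0 // big_ord0.
  rewrite big_ord0 cn mulr1 leeDl //; apply: nneseries_ge0 => k _ _.
  by rewrite lee_fin mulr_ge0 // big_ord0.
(* The n-th term of the induction hypothesis for the slice at t, where the selector also requires
   that the n-th box meets the slice. *)
pose f n (t : R) : \bar R :=
 (((c n && (a n d < t <= b n d))%:R * \prod_(i < d) (b n i - a n i)))%:E.
have vol0 n : 0 <= \prod_(i < d) (b n i - a n i).
  by apply: prodr_ge0 => i _; rewrite subr_ge0.
have le t : `]A d, B d]%classic t ->
    ((\prod_(i < d) (B i - A i))%:E <= \sum_(0 <= n <oo) f n t)%E.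
  rewrite /= in_itv /= => tAB.
  apply: IH => x xAB.
  have [|n cn xn] := cov (fun i => if i == d then t else x i).
    move=> i; rewrite ltnS leq_eqVlt; case: eqP => [-> //|_ /=]; exact: xAB.
  exists n; first by rewrite cn; have := xn d (ltnSn d); rewrite eqxx.
  move=> i id; have := xn i (ltnW id); rewrite ltn_eqF //.
have mI (u v : R) : measurable (`]u, v]%classic : set R) by [].
have lenI (u v : R) : u <= v ->
    lebesgue_measure (`]u, v]%classic : set R) = (v - u)%:E.
  move=> uv; rewrite lebesgue_measure_itv /= lte_fin -EFinB.
  by case: ltP => // vu; rewrite (@le_anti _ _ u v) ?uv // subrr.
pose k n := (c n)%:R * \prod_(i < d) (b n i - a n i).
have fE n : f n = EFin \o (fun t => k n * \1_(`]a n d, b n d]%classic) t).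
  apply/funext => t; rewrite /f /k /= indicE mem_setE /= in_itv /=.
  by case: (c n); rewrite ?mul0r //= mul1r mulrC.
have mf n : measurable_fun (setT : set R) (f n).
  rewrite fE; apply/measurable_EFinP; apply: measurable_funM => //.
have f0 n t : (0 <= f n t)%E by rewrite lee_fin mulr_ge0.
rewrite big_ord_recr /= EFinM -lenI // -integral_cst //.
apply: (@le_trans _ _
  (\int[lebesgue_measure]_(t in `]A d, B d]) \sum_(0 <= n <oo) f n t)%E).
  apply: ge0_le_integral => //.
  - by move=> t _; rewrite lee_fin; apply: prodr_ge0 => i _; rewrite subr_ge0.
  - apply: (@ge0_emeasurable_sum _ _ R _ f xpredT) => // n _.
    exact: measurable_funTS.
rewrite integral_nneseries //; last first.
  by move=> n; apply: measurable_funTS; exact: mf.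
apply: lee_nneseries => n *; first by apply: integral_ge0.
apply: (@le_trans _ _ (\int[lebesgue_measure]_t f n t)%E).
  by apply: ge0_subset_integral => //; exact: mf.
under eq_integral do rewrite fE /= EFinM.
rewrite ge0_integralZl //; last 2 first.
- by apply/measurable_EFinP.
- by rewrite lee_fin mulr_ge0.
rewrite integral_indic // setIT [X in (_ * X)%E](lenI _ _ (ab n d)) -EFinM.
by rewrite big_ord_recr mulrA.
Qed.

Lemma lebesgue_outer_box (R : realType) d (a b : 'rV[R]_d.+1) :
  (forall i, a 0 i <= b 0 i) ->
  ((box_volume a b)%:E <= lebesgue_outer (box a b))%E.
Proof.
move=> ab; apply: le_ereal_inf_tmp => _ [F [F0 abF] <-].
have := @prod_le_nneseries R d.+1 (fun i => a 0 (inord i))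
  (fun i => b 0 (inord i)) (fun n i => (F n).1 0 (inord i))
  (fun n i => (F n).2 0 (inord i)) xpredT (fun i => ab _) (fun n i => F0 n _).
under eq_bigr do rewrite inord_val.
under eq_eseriesr => n _.
  under eq_bigr do rewrite inord_val.
  rewrite mul1r; over.
apply=> x xab.
have [|n _ Fx] := abF (\row_i x i).
  by move=> i; rewrite mxE; have := xab i (ltn_ord i); rewrite inord_val.
by exists n => // i id; have := Fx (inord i); rewrite mxE inordK.
Qed.

(** * Euclidean norm and cubes *)

Lemma enorm_mulmx_orthogonal (R : realType) d (v : 'rV[R]_d) (O : 'M[R]_d) :
  orthogonal_group O -> enorm (v *m O) = enorm v.
Proof.
have sqE (w : 'rV[R]_d) : \sum_(i < d) w 0 i ^+ 2 = (w *m w^T) 0 0.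
  by rewrite mxE; apply: eq_bigr => i _; rewrite mxE.
by move=> OO; rewrite /enorm !sqE trmx_mul mulmxA -(mulmxA v) OO mulmx1.
Qed.

Lemma enormZ (R : realType) d (r : R) (v : 'rV[R]_d) :
  0 <= r -> enorm (r *: v) = r * enorm v.
Proof.
move=> r0; rewrite /enorm (eq_bigr (fun i => r ^+ 2 * v 0 i ^+ 2)); last first.
  by move=> i _; rewrite mxE exprMn.
by rewrite -mulr_sumr sqrtrM ?sqr_ge0 // sqrtr_sqr ger0_norm.
Qed.

Lemma ler_norm_enorm (R : realType) d (v : 'rV[R]_d) i : `|v 0 i| <= enorm v.
Proof.
rewrite -sqrtr_sqr ler_wsqrtr // (bigD1 i) //= lerDl.
by apply: sumr_ge0 => j _; exact: sqr_ge0.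
Qed.

Lemma enorm_ler (R : realType) d (v : 'rV[R]_d) (c : R) :
  0 <= c -> (forall i, `|v 0 i| <= c) -> enorm v <= d%:R * c.
Proof.
move=> c0 vc.
have dc0 : 0 <= d%:R * c by rewrite mulr_ge0.
rewrite -(ger0_norm dc0) -sqrtr_sqr ler_wsqrtr //.
apply: (@le_trans _ _ (\sum_(i < d) c ^+ 2)).
  by apply: ler_sum => i _; rewrite -(real_normK (num_real _)) lerXn2r ?nnegrE.
rewrite sumr_const card_ord -[_ ^+ 2 *+ _]mulr_natl exprMn.
rewrite ler_wpM2r ?sqr_ge0 //.
by rewrite -natrX ler_nat; case: (d) => // n; rewrite -mulnn leq_pmull.
Qed.

Lemma enorm_gt0 (R : realType) d (v : 'rV[R]_d) : v != 0 -> 0 < enorm v.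
Proof.
apply: contraNT; rewrite -leNgt => v0; apply/eqP/rowP => i; rewrite mxE.
by apply/eqP; rewrite -normr_le0 (le_trans (ler_norm_enorm _ _)).
Qed.

Definition cube (R : realType) d (eps rho : R) : set 'rV[R]_d :=
  box (const_mx rho) (const_mx ((1 + eps) * rho)).

Lemma cubeP (R : realType) d (eps rho : R) (w : 'rV[R]_d) :
  cube eps rho w <-> forall i, rho < w 0 i <= (1 + eps) * rho.
Proof. by split=> wi i; have := wi i; rewrite !mxE. Qed.

Lemma enorm_sub_cube (R : realType) d (eps rho : R) (w w' : 'rV[R]_d) :
  0 <= eps -> 0 <= rho -> cube eps rho w -> cube eps rho w' ->
  enorm (w - w') <= d%:R * (eps * rho).
Proof.
move=> eps0 rho0 /cubeP wr /cubeP wr'; apply: enorm_ler; first exact: mulr_ge0.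
move=> i; rewrite !mxE ler_norml.
by move: (wr i) (wr' i) => /andP[? ?] /andP[? ?]; apply/andP; split; lra.
Qed.

Lemma enorm_translate_cube (R : realType) d (eps rho : R) (x y : 'rV[R]_d.+1) :
  0 <= eps <= 1 -> 0 < rho -> cube eps rho (x + y) ->
  5 * d.+1%:R * enorm x < enorm y ->
  rho / 2 <= enorm y <= 3 * d.+1%:R * rho.
Proof.
move=> /andP[eps0 eps1] rho0 /cubeP xyr xy.
have X0 : 0 <= enorm x by exact: sqrtr_ge0.
have epsr : eps * rho <= rho by rewrite ler_piMl // ltW.
have D0 : 0 < d.+1%:R :> R by rewrite ltr0n.
have yb i : rho - enorm x <= y 0 i <= 2 * rho + enorm x.
  have := ler_norm_enorm x i; rewrite ler_norml => /andP[? ?].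
  by have := xyr i; rewrite mxE => /andP[? ?]; apply/andP; split; lra.
have yle : enorm y <= d.+1%:R * (2 * rho + enorm x).
  apply: enorm_ler => [|i]; first by lra.
  by have /andP[? ?] := yb i; rewrite ler_norml; apply/andP; split; lra.
(* Otherwise 2 rho + |x| < 5 |x|, so [yle] contradicts the assumed lower bound on |y|. *)
have xrho : 2 * enorm x <= rho by rewrite leNgt; apply/negP => ?; nra.
have := ler_norm_enorm y 0; have /andP[? ?] := yb 0.
have := ler_norm (y 0 0) => ? ?; apply/andP; split; first by lra.
by nra.
Qed.

(** The order of quantifiers matters: [N] and [eps] define the set, so they precede x; only the
    threshold [R0] may depend on x. *)
Lemma geometric_cubes_avoid (R : realType) d (u v : 'rV[R]_d.+1) :
  u != 0 -> v != 0 -> u != v ->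
  exists N : nat, exists2 eps : R, 0 < eps <= 1 &
    forall x, exists2 R0 : R, 0 < R0 &
    forall (r : R) (O : 'M[R]_d.+1) (n m : nat),
      R0 < r -> orthogonal_group O ->
      cube eps (N.+2%:R ^+ n) (x + r *: (u *m O)) ->
      cube eps (N.+2%:R ^+ m) (x + r *: (v *m O)) -> False.
Proof.
move=> u0 v0 uv.
set a := enorm u; set b := enorm v; set c := enorm (u - v).
set D : R := d.+1%:R.
have a0 : 0 < a by exact: enorm_gt0.
have b0 : 0 < b by exact: enorm_gt0.
have c0 : 0 < c by apply: enorm_gt0; rewrite subr_eq0.
have D0 : 0 < D by rewrite ltr0n.
(* 6 D is the ratio of the constants 3 D and 1/2 of [enorm_translate_cube]. *)
pose N := Num.bound (6 * D * (a / b) + 6 * D * (b / a)).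
have [Na Nb] : 6 * D * a < N.+2%:R * b /\ 6 * D * b < N.+2%:R * a.
  have ab0 : 0 < 6 * D * (a / b) by rewrite !mulr_gt0 ?invr_gt0.
  have ba0 : 0 < 6 * D * (b / a) by rewrite !mulr_gt0 ?invr_gt0.
  have NN : N%:R < N.+2%:R :> R by rewrite ltr_nat.
  have := archi_boundP (ltW (addr_gt0 ab0 ba0)); rewrite -/N => ?.
  by split; rewrite -ltr_pdivrMr // -mulrA; lra.
pose eps := c / (2 * D * a + c).
have den0 : 0 < 2 * D * a + c by rewrite addr_gt0 // !mulr_gt0.
have eps0 : 0 < eps by rewrite divr_gt0.
have eps1 : eps <= 1.
  by rewrite ler_pdivrMr // mul1r lerDr ltW // !mulr_gt0.
have epsc : 2 * D * a * eps < c.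
  by rewrite mulrA ltr_pdivrMr //; have := mulr_gt0 c0 c0; lra.
exists N, eps => [|x]; first by rewrite eps0.
have X0 : 0 <= enorm x by exact: sqrtr_ge0.
have R00 : 0 <= 5 * D * enorm x by rewrite !mulr_ge0 // ltW.
(* Makes both r a and r b exceed 5 D |x|; the 1 keeps it positive when x = 0. *)
exists (5 * D * enorm x / a + 5 * D * enorm x / b + 1).
  by rewrite ltr_wpDl // addr_ge0 // divr_ge0 // ltW.
move=> r O n m rR OO xu xv.
have xa : 5 * D * enorm x < r * a.
  rewrite -ltr_pdivrMr //.
  have : 0 <= 5 * D * enorm x / b by rewrite divr_ge0 // ltW.
  lra.
have xb : 5 * D * enorm x < r * b.
  rewrite -ltr_pdivrMr //.
  have : 0 <= 5 * D * enorm x / a by rewrite divr_ge0 // ltW.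
  lra.
have r0 : 0 < r by rewrite -(pmulr_lgt0 _ a0); exact: le_lt_trans xa.
have rw w : enorm (r *: (w *m O)) = r * enorm w.
  by rewrite enormZ ?enorm_mulmx_orthogonal // ltW.
have N0 k : 0 < N.+2%:R ^+ k :> R by rewrite exprn_gt0.
have eps01 : 0 <= eps <= 1 by rewrite ltW.
have := enorm_translate_cube eps01 (N0 n) xu; rewrite rw => /(_ xa)/andP[un nu].
have := enorm_translate_cube eps01 (N0 m) xv; rewrite rw => /(_ xb)/andP[vm mv].
have le_expr k l : (k < l)%N -> N.+2%:R * N.+2%:R ^+ k <= N.+2%:R ^+ l :> R.
  by move=> kl; rewrite -exprS ler_weXn2l // ler1n.
(* With K = N + 2: K r s <= 3 D K^(k+1) <= 3 D K^l <= 6 D r t, against 6 D t < K s. *)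
have sep s t k l : 6 * D * t < N.+2%:R * s -> N.+2%:R ^+ l / 2 <= r * t ->
    r * s <= 3 * D * N.+2%:R ^+ k -> (k < l)%N -> False.
  move=> st tl sk /le_expr kl.
  have : r * (6 * D * t) < r * (N.+2%:R * s) by rewrite ltr_pM2l.
  have : N.+2%:R * (r * s) <= N.+2%:R * (3 * D * N.+2%:R ^+ k).
    by rewrite ler_pM2l.
  have : 6 * D * (N.+2%:R ^+ l / 2) <= 6 * D * (r * t).
    by rewrite ler_pM2l // mulr_gt0.
  have : 3 * D * (N.+2%:R * N.+2%:R ^+ k) <= 3 * D * N.+2%:R ^+ l.
    by rewrite ler_pM2l // mulr_gt0.
  lra.
case: (ltngtP n m) => [nm|mn|nm].
- exact: sep Nb vm nu nm.
- exact: sep Na un mv mn.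
(* Same cube: r c <= D eps K^n <= 2 D eps r a < r c. *)
rewrite -nm in xv.
have := enorm_sub_cube (ltW eps0) (ltW (N0 n)) xu xv.
rewrite opprD addrACA subrr add0r -scalerBr -mulmxBl rw -/c => rc.
have : r * (2 * D * a * eps) < r * c by rewrite ltr_pM2l.
have : D * eps * (N.+2%:R ^+ n / 2) <= D * eps * (r * a).
  by rewrite ler_pM2l // mulr_gt0.
move: rc; rewrite -/D; lra.
Qed.

(** The ball of radius 3 D rho contains the cube of scale rho and side eps rho, so the quotient is
    at least (eps / (3 D))^(d+1) at arbitrarily large radii. *)
Lemma upper_density_gt0 (R : realType) d (N : nat) (eps : R)
    (E : set 'rV[R]_d.+1) :
  0 < eps <= 1 -> (forall n, cube eps (N.+2%:R ^+ n) `<=` E) ->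
  (0 < upper_density E)%E.
Proof.
move=> /andP[eps0 eps1] cubeE.
set D : R := d.+1%:R; have D0 : 0 < D by rewrite ltr0n.
pose q := eps / (3 * D).
have q0 : 0 < q by rewrite divr_gt0 // mulr_gt0.
apply: (@lt_le_trans _ _ (q ^+ d.+1)%:E); first by rewrite lte_fin exprn_gt0.
apply: le_ereal_inf_tmp => _ [V [M [_ MV]] <-].
pose n := Num.bound `|M|; pose rho : R := N.+2%:R ^+ n.
have rho0 : 0 < rho by rewrite exprn_gt0.
have Mrho : M < rho.
  apply: le_lt_trans (ler_norm M) _.
  apply: lt_trans (archi_boundP (normr_ge0 M)) _.
  by rewrite /rho -natrX ltr_nat ltn_expl.
have Mr : M < 3 * D * rho.
  have D1 : 1 <= D by rewrite ler1n.
  by apply: lt_le_trans Mrho _; rewrite ler_peMl ?ltW //; lra.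
apply: le_trans (ereal_sup_ubound _); last first.
  by exists (3 * D * rho); [exact: MV|reflexivity].
have -> : q ^+ d.+1 = (eps * rho) ^+ d.+1 * ((3 * D * rho) ^+ d.+1)^-1.
  rewrite -exprVn -exprMn; congr (_ ^+ _); rewrite /q; field.
  by rewrite !gt_eqF.
rewrite EFinM; apply: lee_wpmul2r.
  by rewrite lee_fin invr_ge0 exprn_ge0 // !mulr_ge0 // ltW.
have -> : (eps * rho) ^+ d.+1 =
    box_volume (const_mx rho) (const_mx ((1 + eps) * rho) : 'rV[R]_d.+1).
  rewrite /box_volume (eq_bigr (fun=> eps * rho)).
    by rewrite prodr_const card_ord.
  by move=> i _; rewrite !mxE; ring.
apply: le_trans (lebesgue_outer_box _) _.
  by move=> i; rewrite !mxE ler_pMl //; lra.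
apply: le_lebesgue_outer => w wc; split; last exact: (cubeE n).
rewrite /eball /= subr0.
apply: (@le_lt_trans _ _ (D * (2 * rho))); last first.
  by have := mulr_gt0 D0 rho0; lra.
apply: enorm_ler => [|i]; first by rewrite mulr_ge0 // ltW.
have /cubeP/(_ i)/andP[? ?] := wc.
have : eps * rho <= rho by rewrite ler_piMl // ltW.
by move=> ?; rewrite ler_norml; apply/andP; split; lra.
Qed.

Theorem theorem1p1 (R : realType) (d k : nat) (hd : (2 <= d)%N)
  (hk : (3 <= k)%N) (p : 'I_k -> 'rV[R]_d) (p_inj : injective p)
  (p_noncollinear : forall i j l : 'I_k, i != j -> j != l -> i != l ->
    ~ collinear [set p i; p j; p l]) :
  exists E : set 'rV[R]_d,
    [/\ lebesgue_measurable E,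
        (0 < upper_density E)%E
      & forall x, E x -> exists R0 : R, 0 < R0 /\
          `]R0, +oo[%classic `&` pinned_scaling (range p) E x = set0].
Proof.
case: d hd p p_inj p_noncollinear => // d _ p p_inj _.
(* At most one of three distinct points is the origin. *)
have [i [j [pi0 pj0 pij]]] : exists i j, [/\ p i != 0, p j != 0 & p i != p j].
  case: k hk p p_inj => [|[|[|k]]] // _ p p_inj.
  have pneq i j : i != j -> p i != p j by rewrite (inj_eq p_inj).
  pose i0 : 'I_k.+3 := inord 0; pose i1 : 'I_k.+3 := inord 1.
  pose i2 : 'I_k.+3 := inord 2.
  have n01 : p i0 != p i1 by apply: pneq; rewrite -val_eqE /= !inordK.
  have n02 : p i0 != p i2 by apply: pneq; rewrite -val_eqE /= !inordK.
  have n12 : p i1 != p i2 by apply: pneq; rewrite -val_eqE /= !inordK.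
  have [p00|p00] := eqVneq (p i0) 0.
    by exists i1, i2; split; rewrite // -p00 eq_sym.
  have [p10|p10] := eqVneq (p i1) 0.
    by exists i0, i2; split; rewrite // -p10 eq_sym.
  by exists i0, i1.
have [N [eps eps01 avoid]] := geometric_cubes_avoid pi0 pj0 pij.
exists (\bigcup_n cube eps (N.+2%:R ^+ n)); split.
- by apply: caratheodory_measurable_bigcup => n; exact: box_measurable.
- by apply: (upper_density_gt0 eps01) => n w ?; exists n.
move=> x _; have [R0 R00 xR0] := avoid x; exists R0; split=> //.
rewrite -subset0 => r [/= rR0 [_ [Q QQ copy]]].
rewrite in_itv /= andbT in rR0.
have [|n _ xi] := copy (x + r *: (p i *m Q)).
  by exists (p i) => //; exists i.
have [|m _ xj] := copy (x + r *: (p j *m Q)).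
  by exists (p j) => //; exists j.
exact: xR0 rR0 QQ xi xj.
Qed.
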